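(* Let $A$, $Q$, $q$, $\sigma$ and $H_{A,Q}$ be as in the context. Then either: (1) $Q\subset \mathbb S^1$, i.e. $Q$ consists of rotations; this condition is equivalent to $H_{A,Q}$ being abelian, and it is also equivalent to the group $\langle \mathfrak S(Q),\sigma\rangle$ being abelian; or (2) $Q$ contains an iet that is not a rotation, and then the group $H_{A,Q}$ is elementary amenable of Chou class $EG_2$ (i.e. it belongs to $EG_2$), it is not virtually nilpotent, it contains a free semigroup on two generators, and it has exponential growth.
   Context: An interval exchange transformation (iet) is a bijection $f:[0,1)\to[0,1)$ for which there is a finite partition of $[0,1)$ into half-open intervals $[a,b)$ on each of which $f$ is a translation. The iets form a group $\mathrm{IET}$ under composition. For $a\in\mathbb R/\mathbb Z$, $R_a\in\mathrm{IET}$ is the rotation $x\mapsto x+a \bmod 1$; the group of all rotations is denoted $\mathbb S^1$. For an integer $q\ge 1$ let $I_i=[\frac{i-1}{q},\frac{i}{q})$, $1\le i\le q$. For $\tau$ in the symmetric group $\mathcal S_q$ on $\{1,\dots,q\}$, $E_\tau$ is the iet that is a translation on each $I_i$ with $E_\tau(I_i)=I_{\tau(i)}$. Put $\mathcal G_{1/q}=\{E_\tau:\tau\in\mathcal S_q\}$; the map $\mathfrak S:\mathcal G_{1/q}\to\mathcal S_q$, $E_\tau\mapsto\tau$, is an isomorphism. $\sigma=\sigma_q$ is the $q$-cycle $(1,2,\dots,q)\in\mathcal S_q$. Setup: $s,m,q\geq 1$ are integers; $\alpha_1,\dots,\alpha_s\in(\mathbb R/\mathbb Z)\setminus(\mathbb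 Q/\mathbb Z)$ are $\mathbb Q$-independent (i.e. $\sum n_i\alpha_i=0$ in $\mathbb R/\mathbb Z$ with $n_i\in\mathbb Z$ forces all $n_i=0$; equivalently, for real representatives, $1,\alpha_1,\dots,\alpha_s$ are linearly independent over $\mathbb Q$); $A=\langle\alpha_1,\dots,\alpha_s\rangle\simeq\mathbb Z^s$ is the subgroup of $\mathbb R/\mathbb Z$ they generate; $g_1,\dots,g_m\in\mathcal G_{1/q}$ and $Q=\langle g_1,\dots,g_m\rangle\le\mathcal G_{1/q}$; and $H_{A,Q}=\langle R_{\alpha_1},\dots,R_{\alpha_s},g_1,\dots,g_m\rangle\le\mathrm{IET}$. Chou classes: $EG_0$ is the class of groups that are finite or abelian; $EG_{n+1}$ is the class of groups obtained from groups in $EG_n$ by one group extension or one direct union. A group is elementary amenable if it belongs to the smallest class containing finite and abelian groups and closed under subgroups, quotients, extensions and direct unions. *)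

(* Defs.v *)
From HB Require Import structures.
From mathcomp Require Import all_boot all_order all_algebra all_fingroup.
From mathcomp Require Import boolp classical_sets cardinality reals.
From mathcomp Require Import lra.

Set Implicit Arguments.
Unset Strict Implicit.
Unset Printing Implicit Defensive.

Import Order.TTheory GRing.Theory Num.Theory.

Local Open Scope classical_set_scope.
Local Open Scope group_scope.

Definition is_subgroup (G : groupType) (A : set G) : Prop :=
  A 1 /\ (forall x y, A x -> A y -> A (x * y^-1)).

Record subgroup (G : groupType) := Subgroup {
  sg_carrier :> set G;
  sg_is_subgroup : is_subgroup sg_carrier }.

Definition subgroup_type (G : groupType) (K : subgroup G) : Type :=
  set_type (sg_carrier K).

Section SubgroupType.
Variables (G : groupType) (K : subgroup G).

HB.instance Definition _ := SubChoice.on (subgroup_type K).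

Fact subgroup_type_closed : group_closed (fun x => x \in sg_carrier K).
Proof.
case: K => A [A1 AV]; split; rewrite /= ?unfold_in; first by apply/mem_set.
by move=> x y; rewrite !unfold_in => /set_mem Ax /set_mem Ay; apply/mem_set/AV.
Qed.

HB.instance Definition _ := @SubChoice_isSubGroup.Build G _ (subgroup_type K)
  subgroup_type_closed.

End SubgroupType.

Coercion subgroup_group (G : groupType) (K : subgroup G) : groupType :=
  subgroup_type K : groupType.

Fact smallest_is_subgroup (G : groupType) (S : set G) :
  is_subgroup (smallest (@is_subgroup G) S).
Proof.
split=> [A [[]]//|x y Sx Sy A [AG SA]].
by apply: (AG.2); [apply: Sx|apply: Sy].
Qed.

Definition subgroup_gen (G : groupType) (S : set G) : subgroup G :=
  Subgroup (smallest_is_subgroup S).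

Definition finite_group (G : groupType) : Prop := finite_set [set: G].

Definition abelian_group (G : groupType) : Prop := forall x y : G, commute x y.

Definition short_exact (N G K : groupType)
    (i : {multiplicative N -> G}) (p : {multiplicative G -> K}) : Prop :=
  [/\ injective i, range p = [set: K] & forall x, p x = 1 <-> range i x].

Definition is_extension (N G K : groupType) : Prop :=
  exists (i : {multiplicative N -> G}) (p : {multiplicative G -> K}),
    short_exact i p.

Definition is_direct_union (G : groupType) (I : Type) (K : I -> subgroup G) :=
  (forall i j, exists k, K i `<=` K k /\ K j `<=` K k) /\
  \bigcup_i (K i : set G) = [set: G].

Inductive elementary_amenable : groupType -> Prop :=
| EA_finite (G : groupType) : finite_group G -> elementary_amenable G
| EA_abelian (G : groupType) : abelian_group G -> elementary_amenable G
| EA_sub (G H : groupType) (i : {multiplicative H -> G}) :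
    injective i -> elementary_amenable G -> elementary_amenable H
| EA_quotient (G H : groupType) (p : {multiplicative G -> H}) :
    range p = [set: H] -> elementary_amenable G -> elementary_amenable H
| EA_extension (N G K : groupType) :
    is_extension N G K -> elementary_amenable N -> elementary_amenable K ->
    elementary_amenable G
| EA_direct_union (G : groupType) (I : Type) (K : I -> subgroup G) :
    is_direct_union K -> (forall i, elementary_amenable (K i)) ->
    elementary_amenable G.

Fixpoint chou_EG (n : nat) (G : groupType) : Prop :=
  match n with
  | 0 => finite_group G \/ abelian_group G
  | k.+1 =>
      (exists N K : groupType, [/\ chou_EG k N, chou_EG k K & is_extension N G K]) \/
      (exists (I : Type) (K : I -> subgroup G),
         (forall i, chou_EG k (K i)) /\ is_direct_union K)
  end.

Fixpoint lower_central {G : groupType} (n : nat) : set G :=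
  match n with
  | 0 => [set: G]
  | k.+1 => subgroup_gen
      [set z | exists x y : G, lower_central k x /\ z = [~ x, y]]
  end.

Definition nilpotent_group (G : groupType) : Prop :=
  exists n, lower_central n = [set 1 : G].

Definition finite_index (G : groupType) (K : subgroup G) : Prop :=
  finite_set (range (fun x : G => [set x * y | y in (K : set G)])).

Definition virtually_nilpotent (G : groupType) : Prop :=
  exists K : subgroup G, finite_index K /\ nilpotent_group K.

(* The free semigroup on two generators is the set of nonempty words over
   bool under concatenation. *)
Definition contains_free_semigroup2 (G : groupType) : Prop :=
  exists a b : G,
    {in [pred w : seq bool | w != [::]] &,
      injective (fun w => \prod_(t <- w) (if t then a else b))}.

(* The duplicate-free list of the elements of word length at most n. *)
Fixpoint word_ball (G : groupType) (S : seq G) (n : nat) : seq G :=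
  match n with
  | 0 => [:: 1]
  | k.+1 => undup [seq x * y | x <- word_ball S k,
                               y <- 1 :: S ++ [seq s^-1 | s <- S]]
  end.

Definition generates (G : groupType) (S : seq G) : Prop :=
  subgroup_gen [set` S] = [set: G] :> set G.

(* Growth is measured by the cardinality of balls for the word metric; any
   real rate c > 1 may be lowered to a rational one. *)
Definition exponential_growth (G : groupType) : Prop :=
  (exists S : seq G, generates S) /\
  forall S : seq G, generates S ->
    exists c : rat, (1 < c)%R /\
      forall n, (c ^+ n <= (size (word_ball S n))%:R)%R.

Local Open Scope ring_scope.

Definition I01 (R : realType) : Type := {x : R | x \in `[0, 1[}.

Definition in01 (R : realType) (x : R) (x01 : x \in `[0, 1[) : I01 R :=
  exist (fun x : R => x \in `[0, 1[) x x01.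

Definition piecewise_translation (R : realType) (f : I01 R -> I01 R) : Prop :=
  exists (I : finType) (a b c : I -> R),
    [/\ forall i, [&& 0 <= a i, a i < b i & b i <= 1],
        forall x : I01 R, exists! i, val x \in `[a i, b i[
      & forall i (x : I01 R), val x \in `[a i, b i[ -> val (f x) = val x + c i].

Record iet (R : realType) := Iet {
  iet_fun :> I01 R -> I01 R;
  iet_bij : bijective iet_fun;
  iet_pt : piecewise_translation iet_fun }.

Lemma iet_ext (R : realType) (f g : iet R) : f =1 g -> f = g.
Proof.
case: f g => f fb ft [g gb gt] /= /funext fg; subst g.
by rewrite (Prop_irrelevance fb gb) (Prop_irrelevance ft gt).
Qed.

HB.instance Definition _ (R : realType) := gen_eqMixin (iet R).
HB.instance Definition _ (R : realType) := gen_choiceMixin (iet R).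

Section IetGroup.
Variable R : realType.
Implicit Types f g h : iet R.

(* The intervals may be given with out-of-range or empty ones. *)
Lemma pt_from_cover (f : I01 R -> I01 R) (I : finType) (a b c : I -> R) :
  (forall x : I01 R, exists! i, val x \in `[a i, b i[) ->
  (forall i (x : I01 R), val x \in `[a i, b i[ -> val (f x) = val x + c i) ->
  piecewise_translation f.
Proof.
move=> cov tr.
pose a' i := Num.max 0 (a i); pose b' i := Num.min 1 (b i).
have E i (x : I01 R) : (val x \in `[a' i, b' i[) = (val x \in `[a i, b i[).
  have := valP x; rewrite !in_itv /= => /andP[x0 x1].
  by rewrite /a' /b' ge_max x0 lt_min x1.
exists {i : I | a' i < b' i}, (a' \o val), (b' \o val), (c \o val); split.
- by move=> [i /= ->]; rewrite /a' /b' le_max lexx ge_min lexx.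
- move=> x; have [i [xi ui]] := cov x.
  have Hi : a' i < b' i.
    by move: xi; rewrite -E in_itv /= => /andP[]; apply: le_lt_trans.
  exists (Sub i Hi); split=> [/=|[j Hj] /=]; first by rewrite E.
  by rewrite E => /ui ij; apply: val_inj.
- by move=> [i Hi] x /=; rewrite E => /tr.
Qed.

Lemma iet_id_pt : piecewise_translation (@id (I01 R)).
Proof.
apply: (@pt_from_cover _ unit (fun=> 0) (fun=> 1) (fun=> 0)).
- by move=> x; exists tt; split=> [|[]//]; exact: valP.
- by move=> _ x _; rewrite addr0.
Qed.

Definition iet1 : iet R := Iet (Bijective (fun=> erefl) (fun=> erefl)) iet_id_pt.

Lemma iet_mul_pt f g : piecewise_translation (f \o g).
Proof.
have [I [a [b [c [_ gcov gtr]]]]] := iet_pt g.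
have [J [a' [b' [c' [_ fcov ftr]]]]] := iet_pt f.
pose A (p : I * J) := Num.max (a p.1) (a' p.2 - c p.1).
pose B (p : I * J) := Num.min (b p.1) (b' p.2 - c p.1).
have E p (x : I01 R) : (val x \in `[A p, B p[) =
    (val x \in `[a p.1, b p.1[) && (val (g x) \in `[a' p.2, b' p.2[).
  have [xi|xi] := boolP (val x \in `[a p.1, b p.1[).
    rewrite (gtr _ _ xi); move: xi; rewrite !in_itv /= => /andP[x0 x1].
    by rewrite /A /B ge_max lt_min x0 x1 /= lerBlDr ltrBrDr.
  apply/negbTE; apply: contra xi; rewrite !in_itv /= /A /B ge_max lt_min.
  by move=> /andP[/andP[-> _] /andP[-> _]].
apply: (@pt_from_cover _ (I * J)%type A B (fun p => c p.1 + c' p.2)).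
- move=> x; have [i [xi ui]] := gcov x; have [j [xj uj]] := fcov (g x).
  exists (i, j); split=> [|[i' j']]; rewrite E /= ?xi ?xj//.
  by move=> /andP[/ui -> /uj ->].
- by move=> p x; rewrite E => /andP[xi xj]; rewrite /= (ftr _ _ xj) (gtr _ _ xi) addrA.
Qed.

Definition iet_mul f g : iet R :=
  Iet (bij_comp (iet_bij f) (iet_bij g)) (iet_mul_pt f g).

Lemma iet_inv_subproof f :
  {g : I01 R -> I01 R | cancel f g /\ cancel g f}.
Proof. by apply: cid; have [g fK gK] := iet_bij f; exists g. Qed.

Definition iet_inv_fun f := sval (iet_inv_subproof f).

Lemma iet_funK f : cancel f (iet_inv_fun f).
Proof. exact: (svalP (iet_inv_subproof f)).1. Qed.

Lemma iet_inv_funK f : cancel (iet_inv_fun f) f.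
Proof. exact: (svalP (iet_inv_subproof f)).2. Qed.

Lemma iet_inv_pt f : piecewise_translation (iet_inv_fun f).
Proof.
have [I [a [b [c [bnd cov tr]]]]] := iet_pt f.
have E i (x : I01 R) : (val x \in `[a i + c i, b i + c i[) =
    (val (iet_inv_fun f x) \in `[a i, b i[).
  apply/idP/idP => [xi|yi].
    have yi : val x - c i \in `[a i, b i[.
      by move: xi; rewrite !in_itv /= lerBrDr ltrBlDr.
    have y01 : val x - c i \in `[0, 1[.
      move: yi (bnd i); rewrite !in_itv /= => /andP[y0 y1] /and3P[a0 _ b1].
      by rewrite (le_trans a0 y0) (lt_le_trans y1 b1).
    have -> : x = f (in01 y01) by apply: val_inj; rewrite (tr i) //= subrK.
    by rewrite iet_funK.
  rewrite -{1}[x](iet_inv_funK f) (tr _ _ yi).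
  by move: yi; rewrite !in_itv /= lerD2r ltrD2r.
apply: (@pt_from_cover _ I (fun i => a i + c i) (fun i => b i + c i)
  (fun i => - c i)).
- move=> x; have [i [xi ui]] := cov (iet_inv_fun f x).
  by exists i; split=> [|j]; rewrite E //; apply: ui.
- move=> i x; rewrite E => xi.
  by rewrite -{2}[x](iet_inv_funK f) (tr _ _ xi) addrK.
Qed.

Definition iet_inv f : iet R :=
  Iet (Bijective (@iet_inv_funK f) (@iet_funK f)) (iet_inv_pt f).

Fact iet_mulA : associative iet_mul.
Proof. by move=> f g h; apply: iet_ext. Qed.
Fact iet_mul1 : left_id iet1 iet_mul.
Proof. by move=> f; apply: iet_ext. Qed.
Fact iet_mulr1 : right_id iet1 iet_mul.
Proof. by move=> f; apply: iet_ext. Qed.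
Fact iet_mulV : left_inverse iet1 iet_inv iet_mul.
Proof. by move=> f; apply: iet_ext => x; apply: iet_funK. Qed.
Fact iet_mulrV : right_inverse iet1 iet_inv iet_mul.
Proof. by move=> f; apply: iet_ext => x; apply: iet_inv_funK. Qed.

HB.instance Definition _ := isGroup.Build (iet R)
  iet_mulA iet_mul1 iet_mulr1 iet_mulV iet_mulrV.

End IetGroup.

Section Rotation.
Variable R : realType.
Implicit Types a : R.

Lemma frac_subproof (y : R) : y - (Num.floor y)%:~R \in `[0, 1[.
Proof.
have /andP[h1 h2] := floor_itv y; rewrite in_itv /= subr_ge0 h1 /=.
by rewrite ltrBlDr addrC -[X in _ + X]/(1%:~R) -intrD.
Qed.

Definition rot_fun a (x : I01 R) : I01 R := in01 (frac_subproof (val x + a)).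

Lemma I01_eq_int (x y : I01 R) (k : int) : val x = val y + k%:~R -> x = y.
Proof.
move=> xy; apply: val_inj; rewrite /= xy.
have /andP[y0 y1] := valP y; have := valP x; rewrite /= xy => /andP[x0 x1].
move: y0 y1 x0 x1; rewrite ?bnd_simp => y0 y1 x0 x1.
suff -> : k = 0 by rewrite addr0.
have k1 : k%:~R < 1%:~R :> R by lra.
have k2 : (-1)%:~R < k%:~R :> R by rewrite mulrN1z; lra.
by move: k1 k2; rewrite !ltr_int; case: k {xy x0 x1} => [[]|[]].
Qed.

Lemma rot_funK a : cancel (rot_fun a) (rot_fun (- a)).
Proof.
move=> x; set k := Num.floor (val x + a).
set l := Num.floor (val (rot_fun a x) - a).
apply: (@I01_eq_int _ _ (- (k + l))).
by rewrite /= -/k -/l rmorphN rmorphD /=; lra.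
Qed.

Lemma rot_bij a : bijective (rot_fun a).
Proof.
by exists (rot_fun (- a)); [|rewrite -{2}[a]opprK]; apply: rot_funK.
Qed.

Lemma rot_pt a : piecewise_translation (rot_fun a).
Proof.
set k : R := (Num.floor a)%:~R; set d := a - k.
have /andP[] := frac_subproof a; rewrite !bnd_simp -/k -/d => d0 d1.
have fl (x : I01 R) : (Num.floor (val x + a))%:~R = k + (1 - d <= val x)%R%:R.
  have /andP[] := valP x; rewrite !bnd_simp => x0 x1.
  rewrite /k -[RHS]/(_ + (nat_of_bool _)%:~R) -intrD; congr (_%:~R).
  apply: floor_def; rewrite !intrD -/k.
  have -> : a = d + k by rewrite subrK.
  by case: (leP (1 - d) (val x)) => h; rewrite -?[sval x]/(val x) ?mulr1z ?mulr0z;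
    apply/andP; split; lra.
apply: (@pt_from_cover _ _ bool (fun u => if u then 1 - d else 0)
  (fun u => if u then 1 else 1 - d) (fun u => if u then d - 1 else d)).
- move=> x; have /andP[] := valP x; rewrite !bnd_simp => x0 x1.
  exists (1 - d <= val x); split=> [|u].
    by rewrite in_itv; case: (leP (1 - d) (val x)) => h /=; rewrite ?x0 ?h ?x1.
  by rewrite in_itv; case: (leP (1 - d) (val x)) u => h [] //=;
     rewrite ?x0 ?x1 ?h ?(leNgt, h) // ltNge h.
- move=> u x; rewrite -[LHS]/(val x + a - (Num.floor (val x + a))%:~R) fl.
  rewrite in_itv -[a in LHS](subrK k) -/d.
  by case: (leP (1 - d) (val x)) u => h [] /andP[];
    rewrite /= ?bnd_simp ?mulr1n ?mulr0n => u0 u1; rewrite /= in h; lra.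
Qed.

(* [rotation a] is R_(a mod 1): elements of R/Z are given by arbitrary real
   representatives. *)
Definition rotation a : iet R := Iet (rot_bij a) (rot_pt a).

Definition rotations : set (iet R) := range rotation.

End Rotation.

Section Cells.
Variables (R : realType) (q : nat).
Implicit Type t : 'S_q.

(* The cell [i/q, (i+1)/q[ containing x (cells are numbered from 0); it exists
   as soon as q > 0. *)
Definition cell (x : I01 R) : option 'I_q := insub (Num.truncn (q%:R * val x)).

Definition E_val t (x : I01 R) : R :=
  if cell x is Some i then val x + ((t i)%:R - i%:R) / q%:R else val x.

Lemma cellP (x : I01 R) (i : 'I_q) :
  (val x \in `[i%:R / q%:R, i.+1%:R / q%:R[) <-> cell x = Some i.
Proof.
have q0 : 0 < q%:R :> R by rewrite ltr0n; apply: leq_ltn_trans (ltn_ord i).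
have /andP[] := valP x; rewrite !bnd_simp => x0 x1.
have qx0 : 0 <= q%:R * val x by rewrite mulr_ge0 // ltW.
rewrite in_itv /= ler_pdivrMr // ltr_pdivlMr // [_ * q%:R]mulrC /cell.
split=> [/truncn_def->|]; first by rewrite valK.
case: insubP => //= j _ ji [] <-; rewrite ji; exact: truncn_itv.
Qed.

Lemma cell_some (x : I01 R) : (0 < q)%N -> exists i, cell x = Some i.
Proof.
rewrite -(ltr0n R) => q0; have /andP[] := valP x; rewrite !bnd_simp => x0 x1.
rewrite /cell; case: insubP => [i _ _|]; first by exists i.
have qx0 : 0 <= q%:R * val x by rewrite mulr_ge0 // ltW.
have /andP[h _] := truncn_itv qx0.
case/negP; rewrite -(ltr_nat R); apply: le_lt_trans h _.
by rewrite -[ltRHS]mulr1 ltr_pM2l.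
Qed.

Lemma E_val_cell t (x : I01 R) (i : 'I_q) : cell x = Some i ->
  E_val t x \in `[(t i)%:R / q%:R, (t i).+1%:R / q%:R[.
Proof.
move=> xi; rewrite /E_val xi; move/cellP: xi; rewrite !in_itv /=.
rewrite mulrBl -!natr1 !mulrDl => /andP[h1 h2]; apply/andP; split; lra.
Qed.

Lemma E_subproof t (x : I01 R) : E_val t x \in `[0, 1[.
Proof.
case xi : (cell x) => [i|]; last by rewrite /E_val xi (valP x).
have h := E_val_cell t xi.
move: h; rewrite !in_itv /= => /andP[h1 h2].
have q0 : 0 < q%:R :> R by rewrite ltr0n; apply: leq_ltn_trans (ltn_ord i).
rewrite (le_trans _ h1) ?divr_ge0 ?ler0n //= (lt_le_trans h2) //.
by rewrite ler_pdivrMr // mul1r ler_nat.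
Qed.

Definition E_fun t (x : I01 R) : I01 R := in01 (E_subproof t x).

Lemma E_funK t : cancel (E_fun t) (E_fun t^-1%g).
Proof.
move=> x; apply: val_inj; rewrite /= {1}/E_val.
case xi : (cell x) => [i|].
  have /(cellP (E_fun t x) (t i)) -> := E_val_cell t xi.
  by rewrite permK /= /E_val xi -addrA -mulrDl addrA subrK subrr mul0r addr0.
have -> : E_fun t x = x by apply: val_inj; rewrite /= /E_val xi.
by rewrite xi.
Qed.

Lemma E_bij t : bijective (E_fun t).
Proof.
by exists (E_fun t^-1%g); [|rewrite -{2}[t]invgK]; apply: E_funK.
Qed.

Lemma E_pt t : piecewise_translation (E_fun t).
Proof.
have [q0|q0] := posnP q.
  have -> : E_fun t = id.
    apply/funext => x; apply: val_inj; rewrite /= /E_val.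
    by case: (cell x) => // i; have := ltn_ord i; rewrite {2}q0.
  exact: iet_id_pt.
apply: (@pt_from_cover _ _ 'I_q (fun i => i%:R / q%:R)
  (fun i => i.+1%:R / q%:R) (fun i => ((t i)%:R - i%:R) / q%:R)).
- move=> x; have [i xi] := cell_some x q0; exists i.
  by split=> [|j /cellP]; [apply/cellP|rewrite xi => -[]].
- by move=> i x /cellP xi; rewrite /= /E_val xi.
Qed.

(* The iet translating the i-th cell onto the t(i)-th one. *)
Definition E t : iet R := Iet (E_bij t) (E_pt t).

Definition G_1q : set (iet R) := range E.

(* The image under E_t |-> t of a set of iets.  The product of 'S_q composes
   from left to right, that of iets from right to left, so this map reverses
   products on G_1q; subgroups and their commutativity are not affected. *)
Definition frakS (Q : set (iet R)) : {set 'S_q} := [set t | E t \in Q]%SET.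

Definition sigma : 'S_q := perm (@ordS_inj q).

End Cells.

(* Q-independence of the classes of the alpha i in R/Z: a real represents 0
   in R/Z when it is an integer. *)
Definition Q_independent (R : realType) (s : nat) (alpha : 'I_s -> R) : Prop :=
  forall n : 'I_s -> int,
    (exists k : int, \sum_i (n i)%:~R * alpha i = k%:~R) -> forall i, n i = 0.

(* Main.v *)
Require Import Defs.
From HB Require Import structures.
From mathcomp Require Import all_boot all_order all_algebra all_fingroup.
From mathcomp Require Import boolp classical_sets cardinality reals.
From mathcomp Require Import lra zify.

(** Reduced modulo 1/q, the elements of Q act trivially on the circle and the
    rotation by alpha_i acts as itself.  Hence every f in H induces on
    R / (1/q)Z a rotation by some a ([shifts q f a]), and f |-> a mod 1/q is a
    homomorphism to an abelian group.  Its kernel permutes each fibre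
    {y, y + 1/q, ..., y + (q-1)/q}, so it embeds into a power of the finite
    group S_q, and any subgroup of a power of a finite group is locally finite
    ([determined_by_finite]).  So H is locally finite by abelian, hence
    elementary amenable and in EG_2 ([locally_finite_by_abelian]).

    Everything else follows from tracking discontinuities on the circle R / Z.
    An element E_u of G_{1/q} can only be discontinuous on (1/q)Z, and it is
    continuous there exactly when u commutes with the cycle sigma, that is when
    E_u is a rotation ([regular_E_commute_sigma], [commute_sigma_E]); this also
    gives the description of rotations through the centraliser of sigma.
    Let g = E_u in Q be a non-rotation and T the rotation by an irrational
    alpha.  The cosets m alpha + (1/q)Z are pairwise distinct, T permutes them
    by m |-> m + 1, and g preserves each of them, being discontinuous on the
    coset m = 0 only ([lregular_E]).
    - If g commuted with T its discontinuities would be invariant under T, so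
      H abelian forces Q to consist of rotations.
    - The elements T and T g generate a free semigroup.  Two words with the
      same value have the same length because T acts by a rotation of infinite
      order on R / (1/q)Z; after cancelling a common prefix, an equality gives
      g = w1 w2^-1 with w1 and w2 of the same length, and this product never
      applies g or its inverse on the coset m = 0, so it is continuous there
      ([word_neq], [word_inj]).  A free semigroup forces exponential growth.
    - In a virtually nilpotent group some [~ v, T^k, ..., T^k] with k > 0 and
      v = (g^(T^i))^-1 g^(T^j), i < j, would be trivial
      ([virtually_nilpotent_iter_commg]), whereas each new commutation moves
      the lowest discontinuous coset down by k ([iter_commg_neq1]). *)

Set Implicit Arguments.
Unset Strict Implicit.
Unset Printing Implicit Defensive.

Import Order.TTheory GRing.Theory Num.Theory.

Local Open Scope classical_set_scope.
Local Open Scope group_scope.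

(** * Subgroups, extensions and locally finite groups *)

Section Subgroups.
Variable G : groupType.
Implicit Types (K : subgroup G) (S A : set G) (x y : G).

Lemma subgroup1 K : sg_carrier K 1.
Proof. by case: K => A []. Qed.

Lemma subgroupV K x : sg_carrier K x -> sg_carrier K x^-1.
Proof.
case: K => A [A1 AV] /= Ax; rewrite -[x^-1]mul1g; exact: AV.
Qed.

Lemma subgroupM K x y : sg_carrier K x -> sg_carrier K y -> sg_carrier K (x * y).
Proof.
move=> Kx Ky; rewrite -[y]invgK; case: K Kx Ky => A AG /= Ax Ay.
by apply: AG.2 => //; apply: (@subgroupV (Subgroup AG)).
Qed.

Lemma sub_subgroup_gen S : S `<=` subgroup_gen S.
Proof. by move=> x Sx A [_]; apply. Qed.

Lemma subgroup_gen_sub S A :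
  is_subgroup A -> S `<=` A -> subgroup_gen S `<=` A.
Proof. by move=> AG SA x; apply. Qed.

Lemma subgroup_val K (x : subgroup_type K) : sg_carrier K (val x).
Proof. exact: set_valP. Qed.

Definition in_subgroup K x (Kx : sg_carrier K x) : subgroup_type K :=
  exist _ x (mem_set Kx).

End Subgroups.

Section HomExtension.
Variables (G M : groupType) (f : G -> M).
Hypothesis fM : {morph f : x y / x * y}.

Let f1 : f 1 = 1.
Proof. by apply: (mulgI (f 1)); rewrite -fM !mulg1. Qed.

Let fV x : f x^-1 = (f x)^-1.
Proof. by apply: (mulgI (f x)); rewrite -fM !mulgV f1. Qed.

Fact hom_kernel_subproof : is_subgroup [set x | f x = 1].
Proof. by split=> //= x y fx fy; rewrite fM fV fx fy mulgV. Qed.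

Definition hom_kernel : subgroup G := Subgroup hom_kernel_subproof.

Fact hom_image_subproof : is_subgroup (range f).
Proof.
split; first by exists 1.
by move=> _ _ [x _ <-] [y _ <-]; exists (x * y^-1); rewrite ?fM ?fV.
Qed.

Definition hom_image : subgroup M := Subgroup hom_image_subproof.

Definition hom_corestr (x : G) : subgroup_type hom_image :=
  @in_subgroup _ hom_image (f x) (ex_intro2 _ _ x I erefl).

Fact hom_corestrM : {morph hom_corestr : x y / x * y}.
Proof. by move=> x y; apply: val_inj; rewrite valM /=. Qed.

HB.instance Definition _ :=
  isMultiplicative.Build G (subgroup_type hom_image) hom_corestr hom_corestrM.

Lemma hom_is_extension : is_extension hom_kernel G hom_image.
Proof.
exists (val : subgroup_type hom_kernel -> G), hom_corestr; split.
- exact: val_inj.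
- apply/seteqP; split=> // y _; have [x _ fx] := subgroup_val y.
  by exists x => //; apply: val_inj.
- move=> x; split=> [/(congr1 val)|[k _ <-]].
    by rewrite val1 => fx; exists (@in_subgroup _ hom_kernel x fx).
  by apply: val_inj; rewrite val1 /=; apply: (subgroup_val k).
Qed.

End HomExtension.

Section PowerOfFinite.
Variables (N : groupType) (X : Type) (T : finGroupType) (F : N -> X -> T).
Hypothesis FM : forall x y p, F (x * y) p = F x p * F y p.
Hypothesis F_inj : forall x y, F x =1 F y -> x = y.

Let F1 p : F 1 p = 1.
Proof. by apply: (mulgI (F 1 p)); rewrite -FM !mulg1. Qed.

Let FV x p : F x^-1 p = (F x p)^-1.
Proof. by apply: (mulgI (F x p)); rewrite -FM !mulgV F1. Qed.

Definition same_values (S : seq N) p p' := {in S, forall h, F h p = F h p'}.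

Fact determined_by_subproof (S : seq N) :
  is_subgroup [set x | forall p p', same_values S p p' -> F x p = F x p'].
Proof.
split=> [|x y] /=; first by move=> p p' _; rewrite !F1.
by move=> Sx Sy p p' pp'; rewrite !FM !FV (Sx _ _ pp') (Sy _ _ pp').
Qed.

(** These subgroups play the role of finitely generated ones: [determined_by S]
    contains S, and unlike the subgroup generated by S it is visibly finite. *)
Definition determined_by (S : seq N) : subgroup N := Subgroup (determined_by_subproof S).

Lemma determined_by_direct_union : is_direct_union determined_by.
Proof.
split=> [S1 S2|].
  by exists (S1 ++ S2); split=> x Sx p p' pp'; apply: Sx => h hS; apply: pp';
    rewrite mem_cat hS ?orbT.
apply/seteqP; split=> // x _; exists [:: x] => // p p'; apply; exact: mem_head.
Qed.

(** The tuple of values of S at p ranges over the finite set T^S, and x is known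
    once its value is known at one representative point for each tuple. *)
Lemma determined_by_finite S : finite_group (determined_by S).
Proof.
pose col p := [ffun i : 'I_(size S) => F (tnth (in_tuple S) i) p].
have colP p p' : col p = col p' -> same_values S p p'.
  move=> /ffunP e h /(@tnthP _ _ (in_tuple S)) [i ->].
  by have := e i; rewrite !ffunE.
pose rep (v : {ffun 'I_(size S) -> T}) : option X :=
  if pselect (exists p, col p = v) is left e then Some (projT1 (cid e)) else None.
pose code (x : determined_by S) :=
  [ffun v => if rep v is Some p then F (val x) p else 1].
have code_inj : injective code.
  move=> x y /ffunP e; apply: val_inj; apply: F_inj => p.
  have := e (col p); rewrite !ffunE /rep; case: pselect => [h|[]]; last by exists p.
  have := projT2 (cid h); set p' := projT1 _ => /colP pp'.
  by rewrite (subgroup_val x _ _ pp') (subgroup_val y _ _ pp').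
apply: (@finite_preimage _ _ setT code); last exact: finite_finset.
by move=> x y _ _; exact: code_inj.
Qed.

End PowerOfFinite.

Section TrivialUnion.
Variable G : groupType.

Fact setT_is_subgroup : is_subgroup [set: G]. Proof. by []. Qed.

Lemma abelian_chou_EG1 : abelian_group G -> chou_EG 1 G.
Proof.
move=> Gab; right; exists unit, (fun=> Subgroup setT_is_subgroup); split.
  by move=> _; right => x y; apply: val_inj; rewrite !valM; apply: Gab.
split; first by move=> _ _; exists tt.
by apply/seteqP; split=> // x _; exists tt.
Qed.

End TrivialUnion.

(** The maps [F x] embed the kernel of f into the power T^X, so the kernel is a
    direct union of finite groups, and the image of f is abelian. *)
Lemma locally_finite_by_abelian (G M : groupType) (f : G -> M)
    (fM : {morph f : x y / x * y}) (fab : forall x y, commute (f x) (f y))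
    (X : Type) (T : finGroupType) (F : hom_kernel fM -> X -> T) :
    (forall x y p, F (x * y) p = F x p * F y p) ->
    (forall x y, F x =1 F y -> x = y) ->
  elementary_amenable G /\ chou_EG 2 G.
Proof.
move=> FM F_inj.
have imab : abelian_group (hom_image fM).
  move=> x y; apply: val_inj; rewrite !valM.
  by have [a _ <-] := subgroup_val x; have [b _ <-] := subgroup_val y; apply: fab.
have ext := hom_is_extension fM.
split.
  apply: (EA_extension ext); last exact: EA_abelian.
  apply: (EA_direct_union (determined_by_direct_union FM)) => S.
  apply: EA_finite; exact: determined_by_finite.
left; exists (hom_kernel fM), (hom_image fM); split=> //; last exact: abelian_chou_EG1.
right; exists (seq (hom_kernel fM)), (determined_by FM); split.
  2: exact: determined_by_direct_union.
by move=> S; left; apply: determined_by_finite.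
Qed.

(** * Iterated commutators in virtually nilpotent groups *)

Lemma finite_range_nat_collision (T : Type) (f : nat -> T) :
  finite_set (range f) -> exists i j, (i < j)%N /\ f i = f j.
Proof.
move=> fin; apply: contrapT => nocol.
have f_inj : injective f.
  move=> i j fij; case: (ltngtP i j) => // h; case: nocol.
    by exists i, j.
  by exists j, i.
apply: infinite_nat; apply: sub_finite_set (finite_preimage _ fin).
  by move=> x _; exists x.
by move=> x y _ _; exact: f_inj.
Qed.

Definition iter_commg (G : groupType) (x t : G) n := iter n (fun c => [~ c, t]) x.

Lemma iter_commg_morph (G M : groupType) (f : UMagmaMorphism.type G M) x t n :
  f (iter_commg x t n) = iter_commg (f x) (f t) n.
Proof. by elim: n => //= n IH; rewrite gmulfR IH. Qed.

Lemma nilpotent_iter_commg (G : groupType) (x t : G) :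
  nilpotent_group G -> exists n, iter_commg x t n = 1.
Proof.
move=> [n nil]; exists n; rewrite -[_ = 1]/([set 1 : G] _) -nil.
elim: {nil} n => //= n IH; apply: sub_subgroup_gen; by exists (iter_commg x t n), t.
Qed.

(** A subgroup K of finite index meets every sequence of cosets in a collision:
    it contains some u_i^-1 u_j, and also a positive power of t.  Iterated
    commutators of two elements of the nilpotent group K vanish. *)
Lemma virtually_nilpotent_iter_commg (G : groupType) (u : nat -> G) (t : G) :
  virtually_nilpotent G ->
  exists i j k l : nat, [/\ (i < j)%N, (0 < k)%N &
    iter_commg ((u i)^-1 * u j) (t ^+ k) l = 1].
Proof.
move=> [K [Kfin Knil]].
have collide (v : nat -> G) : exists i j, (i < j)%N /\ sg_carrier K ((v i)^-1 * v j).
  pose coset (x : G) := [set x * y | y in (K : set G)].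
  have [] := @finite_range_nat_collision _ (fun n => coset (v n)).
    by apply: sub_finite_set Kfin => _ [n _ <-]; exists (v n).
  move=> i [j [ij e]]; exists i, j; split=> //.
  have : coset (v j) (v j) by exists 1; rewrite ?mulg1 //; apply: subgroup1.
  by rewrite -e => -[y Ky <-]; rewrite mulKg.
have [i [j [ij Kuij]]] := collide u.
have [a [b [ab Kt]]] := collide (fun n => t ^+ n).
have {}Kt : sg_carrier K (t ^+ (b - a)).
  by move: Kt; rewrite -{1}(subnK (ltnW ab)) addnC expgnDr mulKg.
have [l e] := nilpotent_iter_commg (in_subgroup Kuij) (in_subgroup Kt) Knil.
exists i, j, (b - a)%N, l; split=> //; first by rewrite subn_gt0.
have := iter_commg_morph (val : subgroup_type K -> G)
  (in_subgroup Kuij) (in_subgroup Kt) l.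
by move=> <-; rewrite e; exact: val1.
Qed.

(** * Exponential growth *)

Section Growth.
Variable G : groupType.
Implicit Types (S : seq G) (x y : G).

Lemma word_ballP S n x : reflect
    (exists y z, [/\ y \in word_ball S n, z \in 1 :: S ++ [seq s^-1 | s <- S]
                   & x = y * z])
    (x \in word_ball S n.+1).
Proof.
have -> : word_ball S n.+1 = undup [seq a * b | a <- word_ball S n,
  b <- 1 :: S ++ [seq s^-1 | s <- S]] by [].
rewrite mem_undup; apply: (iffP (@allpairsPdep G (fun=> G) G _ _ _ _)).
  by move=> [y [z [yn zn ->]]]; exists y, z.
by move=> [y [z [yn zn ->]]]; exists y, z.
Qed.

Lemma word_ballS S n : {subset word_ball S n <= word_ball S n.+1}.
Proof.
move=> x xn; apply/word_ballP; exists x, 1; split; rewrite ?mulg1 //; exact: mem_head.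
Qed.

Lemma word_ball1 S x : x \in 1 :: S ++ [seq s^-1 | s <- S] -> x \in word_ball S 1.
Proof.
by move=> xS; apply/word_ballP; exists 1, x; split; rewrite ?mul1g ?mem_head.
Qed.

Lemma word_ball_mono S m n : (m <= n)%N -> {subset word_ball S m <= word_ball S n}.
Proof.
move=> /subnK <-; elim: (n - m)%N => // k IH x xm.
by rewrite addSn; apply: word_ballS; apply: IH.
Qed.

Lemma word_ballM S m n x y :
  x \in word_ball S m -> y \in word_ball S n -> x * y \in word_ball S (m + n).
Proof.
move=> xm; elim: n y => [|n IH] y.
  by rewrite inE => /eqP ->; rewrite mulg1 addn0.
move=> /word_ballP [z [s [zn sS ->]]]; rewrite addnS mulgA.
by apply/word_ballP; exists (x * z), s; split=> //; apply: IH.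
Qed.

Lemma word_ballV S n x : x \in word_ball S n -> x^-1 \in word_ball S n.
Proof.
elim: n x => [|n IH] x; first by rewrite !inE => /eqP ->; rewrite invg1.
move=> /word_ballP [y [s [yn sS ->]]]; rewrite invgM -add1n.
apply: word_ballM; last exact: IH.
apply: word_ball1; move: sS; rewrite !inE !mem_cat.
case/or3P => [/eqP ->|sS|/mapP [r rS ->]].
- by rewrite invg1 eqxx.
- by rewrite (map_f inv sS) !orbT.
- by rewrite invgK rS orbT.
Qed.

Lemma word_ball_generates S x : generates S -> exists n, x \in word_ball S n.
Proof.
move=> gen; have : [set: G] x by [].
rewrite -gen.
apply: (@subgroup_gen_sub _ _ [set y | exists n, y \in word_ball S n]) => [|s sS].
  split=> [|y z [m ym] [n zn]]; first by exists 0%N; apply: mem_head.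
  by exists (m + n)%N; apply: word_ballM => //; apply: word_ballV.
by exists 1%N; apply: word_ball1; rewrite inE mem_cat [_ \in S]sS orbT.
Qed.

Lemma uniq_word_ball S n : uniq (word_ball S n).
Proof. by case: n => //= n; apply: undup_uniq. Qed.

Lemma size_word_ball S n (I : finType) (h : I -> G) : injective h ->
  (forall i, h i \in word_ball S n) -> (#|I| <= size (word_ball S n))%N.
Proof.
move=> h_inj hn; rewrite cardE -(size_map h); apply: uniq_leq_size.
  by rewrite map_inj_uniq // enum_uniq.
by move=> _ /mapP [i _ ->].
Qed.

Lemma rational_root_of_2 n :
  exists c : rat, (1 < c)%R /\ forall k, (k <= n)%N -> (c ^+ k <= 2)%R.
Proof.
have [->|n_gt0] := posnP n.
  by exists 2%R; split=> // k; rewrite leqn0 => /eqP ->.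
pose d : rat := (2 * n)%:R%R; pose e : rat := (1 - d^-1)%R.
have d2 : (2 <= d)%R by rewrite ler_nat; lia.
have dV0 : (0 < d^-1)%R by rewrite invr_gt0; lra.
have dV1 : (d^-1 <= 2^-1)%R by rewrite lef_pV2 ?posrE //; lra.
(* 1/c = e = 1 - 1/(2n), and Bernoulli's inequality gives e^k >= 1/2 up to n. *)
have bernoulli k : (1 - k%:R / d <= e ^+ k)%R.
  elim: k => [|k IH]; first by rewrite mul0r subr0.
  rewrite exprS; have [h|h] := leP 0%R (1 - k%:R / d)%R; last first.
    apply: (@le_trans _ _ 0%R); last by rewrite -exprS exprn_ge0 // /e; lra.
    by rewrite -natr1 mulrDl mul1r; lra.
  apply: (@le_trans _ _ (e * (1 - k%:R / d)))%R; last first.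
    by apply: ler_wpM2l => //; rewrite /e; lra.
  have : (0 <= k%:R / d)%R by rewrite mulr_ge0 ?ler0n //; lra.
  by rewrite -natr1 mulrDl mul1r /e; nra.
exists e^-1%R; split=> [|k kn]; first by rewrite invf_gt1 /e; lra.
have e0 : (0 < e)%R by rewrite /e; lra.
have half : (2^-1 <= e ^+ k)%R.
  apply: le_trans (bernoulli k).
  have : (k%:R / d <= 2^-1)%R.
    rewrite ler_pdivrMr; last lra.
    have : (k%:R <= n%:R :> rat)%R by rewrite ler_nat.
    by rewrite /d natrM; lra.
  by lra.
by rewrite exprVn -[leRHS]invrK lef_pV2 // posrE ?exprn_gt0 // invr_gt0.
Qed.

(** If the letters of a free semigroup have length at most L for S, the 2^k
    words of k letters are distinct elements of the ball of radius L k.  This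
    gives the rate 2^(1/L) asymptotically; a rate of at most 2^(1/(2 L)) makes
    the bound hold for all n, the radii below 2 L being handled by the fact that
    a ball of positive radius has at least two elements. *)
Lemma free_semigroup_exponential_growth :
  (exists S, generates S) -> contains_free_semigroup2 G -> exponential_growth G.
Proof.
move=> fg [a [b ab_free]]; split=> // S gen.
have [la a_ball] := word_ball_generates a gen.
have [lb b_ball] := word_ball_generates b gen.
pose L := (la + lb).+1.
pose word (w : seq bool) := \prod_(t <- w) (if t then a else b).
have word_inball w : word w \in word_ball S (L * size w).
  elim: w => [|t w IH]; first by rewrite /word big_nil muln0 mem_head.
  rewrite /word big_cons mulnS; apply: word_ballM IH.
  case: t; [move: a_ball|move: b_ball]; apply: word_ball_mono; rewrite /L; lia.
have ball_words k : (2 ^ k <= size (word_ball S (L * k)))%N.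
  case: k => [|k]; first by rewrite muln0.
  have <- : #|{: k.+1.-tuple bool}| = (2 ^ k.+1)%N by rewrite card_tuple card_bool.
  apply: (@size_word_ball _ _ _ (fun w : k.+1.-tuple bool => word w)) => [w w' e|w].
    by apply: val_inj; apply: ab_free e; rewrite inE -size_eq0 size_tuple.
  by have := word_inball w; rewrite size_tuple.
have ball_gt1 n : (0 < n)%N -> (2 <= size (word_ball S n))%N.
  move=> n_gt0; have [s sS s1] : exists2 s, s \in S & s != 1.
    apply: contrapT => noS.
    have G1 (x : G) : x = 1.
      have : [set: G] x by [].
      rewrite -gen; apply: (@subgroup_gen_sub _ _ [set 1]) => [|s sS] /=.
        by split=> //= y z -> ->; rewrite mulgV.
      by apply/eqP/negP => /negP s1; apply: noS; exists s.
    suff: [:: true] = [:: false] :> seq bool by [].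
    by apply: ab_free => //=; rewrite (G1 (\prod_(_ <- _) _)) [RHS]G1.
  apply: (@uniq_leq_size _ [:: 1; s]) => /=; first by rewrite inE eq_sym s1.
  move=> x xs; apply: (word_ball_mono n_gt0); apply: word_ball1.
  by move: xs; rewrite !inE mem_cat => /orP[->//|/eqP ->]; rewrite sS orbT.
have [c [c1 cL]] := rational_root_of_2 (2 * L).
exists c; split=> // n; case: (posnP n) => [->//|n_gt0].
have c0 : (0 <= c)%R by apply: ltW; apply: lt_trans c1.
have [nL|nL] := ltnP n (2 * L).
  apply: (@le_trans _ _ 2%:R%R); first by apply: cL; rewrite ltnW.
  by rewrite ler_nat ball_gt1.
apply: (@le_trans _ _ (2 ^ (n %/ L))%:R%R).
  have q1 : (0 < n %/ L)%N by rewrite divn_gt0 //; lia.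
  have nle : (n <= 2 * L * (n %/ L))%N.
    have := ltn_ceil n (isT : 0 < L)%N; nia.
  apply: (@le_trans _ _ (c ^+ (2 * L * (n %/ L)))%R).
    by rewrite ler_weXn2l // ltW.
  by rewrite exprM natrX lerXn2r ?nnegrE ?exprn_ge0 ?cL.
rewrite ler_nat; apply: leq_trans (ball_words _) _.
apply: uniq_leq_size; first exact: uniq_word_ball.
by apply: word_ball_mono; rewrite mulnC leq_trunc_div.
Qed.

End Growth.

Lemma finite_set_generates (G : groupType) (A : set G) :
  finite_set A -> exists S : seq (subgroup_gen A), generates S.
Proof.
move=> /finite_seqP [s ->]; set H := subgroup_gen _.
have sH x : x \in s -> sg_carrier H x by exact: sub_subgroup_gen.
exists (pmap insub s); apply/seteqP; split=> // x _.
pose A' := [set y | exists2 z : H, val z = y &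
  sg_carrier (subgroup_gen [set` (pmap insub s : seq H)]) z].
have : A' (val x).
  apply: subgroup_gen_sub (subgroup_val x).
    split; first by exists 1 => //; exact: subgroup1.
    move=> _ _ [y <- Hy] [z <- Hz]; exists (y * z^-1); first by rewrite gmulfF.
    by apply: subgroupM => //; apply: subgroupV.
  move=> y ys; exists (in_subgroup (sH y ys)) => //.
  by apply: sub_subgroup_gen; rewrite /= mem_pmap_sub.
by move=> [z /val_inj ->].
Qed.

Local Open Scope ring_scope.

(** * Continuity on the circle *)

Section Circle.
Variable R : realType.
Implicit Types (x y a b t : R) (p : I01 R) (f h : iet R).

(** The projection from R to R / Z, the latter being identified with [0,1[. *)
Definition circ x : I01 R := in01 (frac_subproof x).

Lemma circ_val p : circ (val p) = p.
Proof.
by apply: (@I01_eq_int _ _ _ (- Num.floor (val p))); rewrite /= rmorphN.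
Qed.

Lemma circE x : exists k : int, val (circ x) = x + k%:~R.
Proof. by exists (- Num.floor x); rewrite /= rmorphN. Qed.

Lemma circ_int x y (k : int) : x = y + k%:~R -> circ x = circ y.
Proof.
move=> ->; have [i ix] := circE (y + k%:~R); have [j jy] := circE y.
by apply: (@I01_eq_int _ _ _ (i + k - j)); rewrite ix jy !(rmorphD, rmorphN) /=; lra.
Qed.

Lemma circ_eq_int x y : circ x = circ y -> exists k : int, x = y + k%:~R.
Proof.
move=> xy; have [i ix] := circE x; have [j jy] := circE y.
by exists (j - i); move: ix; rewrite xy jy rmorphD rmorphN /=; lra.
Qed.

Lemma circ_valD p t : circ (val p + t) = rotation t p.
Proof. by []. Qed.

Lemma circ_circ x t : circ (val (circ x) + t) = circ (x + t).
Proof.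
have [k ->] := circE x; apply: (@circ_int _ _ k); lra.
Qed.

Lemma circ_id x : 0 <= x < 1 -> val (circ x) = x.
Proof. by move=> x01; rewrite -[x in LHS]/(val (in01 x01)) circ_val. Qed.

Lemma rotation_circ a x : rotation a (circ x) = circ (x + a).
Proof. exact: circ_circ. Qed.

Lemma rotation_eq a f : (forall p, f p = circ (val p + a)) -> f = rotation a.
Proof. by move=> fa; apply: iet_ext. Qed.

Lemma rotationD a b : rotation (a + b) = (rotation a * rotation b)%g.
Proof.
apply/esym/rotation_eq => p.
rewrite -[LHS]/(rotation a (rotation b p)) -(circ_valD p b) rotation_circ.
by rewrite -addrA [b + a]addrC.
Qed.

(** Continuity of f at the class of x, as a map of the circle R / Z: since f is
    a piecewise translation, it is continuous at a point exactly when it is a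
    translation on both sides of it. *)
Definition continuous_at f x := exists2 e : R, 0 < e &
  forall t, `|t| < e -> f (circ (x + t)) = circ (val (f (circ x)) + t).

Lemma continuous_at_circ f x y : circ x = circ y ->
  continuous_at f x -> continuous_at f y.
Proof.
move=> xy [e e0 fe]; exists e => // t /fe; rewrite xy -[circ (x + t)]circ_circ xy.
by rewrite circ_circ.
Qed.

Lemma continuous_at_mul f h x : continuous_at h x ->
  continuous_at f (val (h (circ x))) -> continuous_at (f * h)%g x.
Proof.
move=> [e e0 he] [d d0 fd]; exists (Num.min e d); first by rewrite lt_min e0.
by move=> t; rewrite lt_min => /andP[/he te /fd]; rewrite circ_val /= te.
Qed.

Lemma continuous_at_inv f x : continuous_at f x ->
  continuous_at f^-1%g (val (f (circ x))).
Proof.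
move=> [e e0 fe]; exists e => // t /fe te.
by rewrite -te circ_val /= !iet_funK circ_circ.
Qed.

Lemma continuous_at_rotation a x : continuous_at (rotation a) x.
Proof.
exists 1 => // t _; rewrite !rotation_circ circ_circ; congr circ; lra.
Qed.

End Circle.

(** * The circle modulo 1/q *)

Section ModQ.
Variables (R : realType) (q : nat).
Hypothesis q_gt0 : (0 < q)%N.
Implicit Types (x y a b t : R) (p : I01 R) (f h : iet R) (u : 'S_q).

Let q0 : 0 < q%:R :> R. Proof. by rewrite ltr0n. Qed.

(** f induces the rotation by a on the quotient circle R / (1/q)Z. *)
Definition shifts f a := forall p, exists k : int, val (f p) = val p + a + k%:~R / q%:R.

Lemma shifts_circ f a x : shifts f a ->
  exists k : int, val (f (circ x)) = x + a + k%:~R / q%:R.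
Proof.
move=> /(_ (circ x)) [k ->]; have [j ->] := circE x.
exists (k + j * q%:Z); rewrite rmorphD rmorphM /= mulrDl -pmulrn mulfK ?gt_eqF //; lra.
Qed.

Lemma shifts1 : shifts 1%g 0.
Proof. by move=> p; exists 0; rewrite mul0r !addr0. Qed.

Lemma shifts_mul f h a b : shifts f a -> shifts h b -> shifts (f * h)%g (a + b).
Proof.
move=> fa hb p; have [i ip] := hb p; have [j jp] := fa (h p).
by exists (i + j); rewrite /= jp ip rmorphD /= mulrDl; lra.
Qed.

Lemma shifts_inv f a : shifts f a -> shifts f^-1%g (- a).
Proof.
move=> fa p; have [k] := fa (iet_inv_fun f p); rewrite iet_inv_funK => kp.
exists (- k); rewrite rmorphN mulNr -[f^-1%g p]/(iet_inv_fun f p); lra.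
Qed.

Lemma shifts_rotation a : shifts (rotation a) a.
Proof.
move=> p; have [k kp] := circE (val p + a); exists (k * q%:Z).
by rewrite rmorphM /= -pmulrn mulfK ?gt_eqF // -kp.
Qed.

Lemma shifts_E u : shifts (E R u) 0.
Proof.
move=> p; have [i ip] := cell_some p q_gt0; exists ((u i)%:Z - i%:Z).
by rewrite /= /E_val ip addr0 rmorphB.
Qed.

Lemma shifts_uniq f a b : shifts f a -> shifts f b ->
  exists k : int, a = b + k%:~R / q%:R.
Proof.
move=> fa fb; have [i e] := fa (circ 0); have [j e'] := fb (circ 0).
by exists (j - i); rewrite rmorphB mulrBl; lra.
Qed.

(** Continuity on a whole coset of (1/q)Z: the elements of H permute these
    cosets, so that the property composes without following individual points. *)
Definition regular f b := forall k : int, continuous_at f (b + k%:~R / q%:R).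

Lemma regular_mul f h a b : shifts h a -> regular h b -> regular f (b + a) ->
  regular (f * h)%g b.
Proof.
move=> ha hb fb k; apply: continuous_at_mul; first exact: hb.
have [j ->] := shifts_circ (b + k%:~R / q%:R) ha.
by have := fb (k + j); rewrite rmorphD mulrDl; congr continuous_at; lra.
Qed.

Lemma regular_inv f a b : shifts f a -> regular f b -> regular f^-1%g (b + a).
Proof.
move=> fa fb k.
have [j e] := shifts_circ (b + a + k%:~R / q%:R) (shifts_inv fa).
set p := (f^-1%g _) in e.
have fp : f p = circ (b + a + k%:~R / q%:R) by apply: iet_inv_funK.
apply: (@continuous_at_circ _ _ (val (f p))); first by rewrite circ_val.
rewrite -[p]circ_val; apply: continuous_at_inv.
by have := fb (k + j); rewrite e rmorphD mulrDl; congr continuous_at; lra.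
Qed.

Lemma regular_rotation a b : regular (rotation a) b.
Proof. by move=> k; apply: continuous_at_rotation. Qed.

Lemma cell_bounds p (i : 'I_q) : cell q p = Some i <->
  i%:R / q%:R <= val p < i%:R / q%:R + q%:R^-1.
Proof. by rewrite -cellP in_itv -natr1 mulrDl mul1r. Qed.

Lemma E_cell u p (i : 'I_q) : cell q p = Some i ->
  val (E R u p) = val p + ((u i)%:R - i%:R) / q%:R.
Proof. by move=> ip; rewrite [LHS]/= /E_val ip. Qed.

Lemma cell01 (i : 'I_q) x : i%:R / q%:R <= x < i%:R / q%:R + q%:R^-1 -> 0 <= x < 1.
Proof.
have i0 : 0 <= i%:R / q%:R :> R by rewrite divr_ge0.
have : i.+1%:R / q%:R <= 1 :> R by rewrite ler_pdivrMr // mul1r ler_nat.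
by rewrite -natr1 mulrDl mul1r => i1 /andP[h1 h2]; apply/andP; split; lra.
Qed.

Lemma E_circ u x (i : 'I_q) : i%:R / q%:R <= x < i%:R / q%:R + q%:R^-1 ->
  E R u (circ x) = circ (x + ((u i)%:R - i%:R) / q%:R).
Proof.
move=> ix; have x01 := cell01 ix; have ci : cell q (circ x) = Some i.
  by apply/cell_bounds; rewrite circ_id.
by rewrite -[LHS]circ_val (E_cell u ci) circ_id.
Qed.

(** The points of (1/q)Z are the end points of the cells. *)
Lemma regular_E u b : (forall k : int, b != k%:~R / q%:R) -> regular (E R u) b.
Proof.
move=> bq k; set x := b + _; have [p px] : exists p, circ x = p by exists (circ x).
have [i ip] := cell_some p q_gt0.
have xp : circ x = circ (val p) by rewrite circ_val.
apply: (continuous_at_circ (esym xp)).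
have /cell_bounds/andP[ip0 ip1] := ip.
(* x is off (1/q)Z, so it is interior to its cell. *)
have {}ip0 : i%:R / q%:R < val p.
  rewrite lt_neqAle ip0 andbT; apply/eqP => ip2.
  have [j jx] := circE x; have /eqP := bq (i%:Z - k - j * q%:Z); apply.
  rewrite !(rmorphB, rmorphM) /= !mulrBl -!pmulrn mulfK ?gt_eqF //.
  by move: ip2 jx; rewrite px /x => -> ->; lra.
exists (Num.min (val p - i%:R / q%:R) (i%:R / q%:R + q%:R^-1 - val p)).
  by rewrite lt_min; apply/andP; split; lra.
move=> t; rewrite lt_min !ltr_norml => /andP[/andP[t1 t2] /andP[t3 t4]].
rewrite (@E_circ _ _ i); last by apply/andP; split; lra.
by rewrite circ_val (E_cell u ip); congr circ; lra.
Qed.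

Lemma sigma_mod (i : 'I_q) :
  exists k : int, (sigma q i)%:R = i%:R + 1 + k%:~R * q%:R :> R.
Proof.
exists (- (i.+1 %/ q)%N%:Z).
have : i.+1%:R = (i.+1 %/ q)%:R * q%:R + (i.+1 %% q)%:R :> R.
  by rewrite -natrM -natrD -divn_eq.
by rewrite permE /= rmorphN /= -pmulrn -natr1; lra.
Qed.

(** Continuity at the common end point of the adjacent cells i and sigma(i) says
    that their images are adjacent in the same order: u o sigma = sigma o u. *)
Lemma regular_E_commute_sigma u : regular (E R u) 0 -> commute u (sigma q).
Proof.
move=> reg; apply/permP => i; rewrite !permM; apply: val_inj.
have qV0 : 0 < q%:R^-1 :> R by rewrite invr_gt0.
have [e e0 /(_ (- (Num.min e q%:R^-1 / 2)))] := reg i.+1.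
set t := _ / 2.
have [t0 [te tq]] : 0 < t /\ t < e /\ t < q%:R^-1.
  by rewrite /t; case: (leP e q%:R^-1) => h; split; try split; lra.
rewrite normrN gtr0_norm // => /(_ te).
rewrite add0r -pmulrn -natr1 mulrDl mul1r.
rewrite (@E_circ _ _ i); last by apply/andP; split; lra.
have [k si] := sigma_mod i.
have -> : circ (i%:R / q%:R + q%:R^-1) = circ ((sigma q i)%:R / q%:R) :> I01 R.
  apply: (@circ_int _ _ _ (- k)); rewrite si !mulrDl mulfK ?gt_eqF // rmorphN mul1r; lra.
rewrite (@E_circ _ _ (sigma q i)); last by apply/andP; split; lra.
rewrite circ_circ => /circ_eq_int [l e1].
have {e1} : ((u i).+1%:Z)%:~R = ((u (sigma q i))%:Z + l * q%:Z)%:~R :> R.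
  rewrite rmorphD rmorphM /= -!pmulrn -natr1.
  apply: (@mulIf _ q%:R^-1); first by rewrite invr_eq0 gt_eqF.
  by rewrite !mulrDl mulfK ?gt_eqF //; lra.
move=> /eqP; rewrite eqr_int => /eqP e1.
have [h1 h2] := (ltn_ord (u (sigma q i)), ltn_ord (u i)).
rewrite [RHS]/(val _) [X in nat_of_ord X = _]permE /=.
case: l e1 => n e1; last by nia.
have -> : (u i).+1 = (n * q + u (sigma q i))%N by lia.
by rewrite modnMDl modn_small.
Qed.

(** A permutation commuting with the full cycle is i |-> u(0) + i modulo q. *)
Lemma commute_sigma_E u : commute u (sigma q) ->
  E R u = rotation ((u (Ordinal q_gt0))%:R / q%:R).
Proof.
move=> /permP uS; set u0 := (u _)%:R : R.
have ui (i : 'I_q) : exists k : int, (u i)%:R = u0 + i%:R + k%:~R * q%:R :> R.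
  case: i => i; elim: i => [|i IH] iq.
    by exists 0; rewrite mul0r !addr0 (bool_irrelevance iq q_gt0).
  have [k IHk] := IH (ltnW iq); set j := Ordinal _ in IHk.
  have -> : u (Ordinal iq) = sigma q (u j).
    have -> : Ordinal iq = sigma q j.
      by apply: val_inj; rewrite permE /= modn_small.
    by have := uS j; rewrite !permM.
  have [l ->] := sigma_mod (u j).
  by exists (k + l); rewrite IHk rmorphD /= -[i.+1%:R]natr1; lra.
apply: rotation_eq => p; have [i ip] := cell_some p q_gt0.
rewrite -[LHS]circ_val (E_cell u ip); have [k ->] := ui i.
by apply: (@circ_int _ _ _ k); rewrite mulrBl !mulrDl mulfK ?gt_eqF //; lra.
Qed.

Lemma E_rotationP u : rotations (E R u) <-> commute u (sigma q).
Proof.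
split=> [[a _ au]|/commute_sigma_E ->]; last by exists ((u (Ordinal q_gt0))%:R / q%:R).
by apply: regular_E_commute_sigma; rewrite -au; apply: regular_rotation.
Qed.

Lemma E_mul u v : E R (u * v)%g = (E R v * E R u)%g.
Proof.
apply: iet_ext => p; have [i ip] := cell_some p q_gt0.
have ujp : cell q (E R u p) = Some (u i).
  by apply/cellP; apply: E_val_cell.
apply: val_inj; rewrite (E_cell _ ip) [RHS](E_cell v (p := E R u p) ujp).
by rewrite (E_cell _ ip) permM; lra.
Qed.

Lemma E_inj : injective (E R (q := q)).
Proof.
move=> u v uv; apply/permP => i; apply: val_inj.
have ii : i%:R / q%:R <= (i%:R / q%:R : R) < i%:R / q%:R + q%:R^-1.
  by rewrite lexx /= ltrDl invr_gt0.
have ci : cell q (circ (i%:R / q%:R : R)) = Some i.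
  by apply/cell_bounds; rewrite circ_id //; apply: cell01 ii.
have := E_cell u ci; rewrite uv (E_cell v ci) => /addrI.
move=> /(mulIf (invr_neq0 (lt0r_neq0 q0))) /addIr /eqP.
by rewrite eqr_nat => /eqP.
Qed.

Lemma E1 : E R (1 : 'S_q)%g = 1%g.
Proof. by apply: (mulgI (E R (1 : 'S_q)%g)); rewrite -E_mul !mulg1. Qed.

Lemma EV u : E R u^-1%g = (E R u)^-1%g.
Proof. by apply: (mulgI (E R u)); rewrite -E_mul mulgV mulVg E1. Qed.

Lemma G_1q_subgroup : is_subgroup (@G_1q R q).
Proof.
split; first by exists 1%g; rewrite ?E1.
by move=> _ _ [u _ <-] [v _ <-]; exists (v^-1 * u)%g; rewrite // E_mul EV.
Qed.

(** Both directions go through the centraliser of sigma: it consists of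
    the u for which E_u is a rotation, and rotations commute with one another. *)
Lemma rotations_abelian_sigma (Q : set (iet R)) : Q `<=` @G_1q R q ->
  Q `<=` @rotations R <->
    abelian <<frakS q Q :|: [set sigma q]%SET>>%g.
Proof.
move=> QG; rewrite abelian_gen.
split=> [Qrot|ab f Qf].
  have rot_commute u v : u \in frakS q Q :|: [set sigma q]%SET ->
      v \in frakS q Q :|: [set sigma q]%SET -> commute u v.
    have rotE w : w \in frakS q Q :|: [set sigma q]%SET -> rotations (E R w).
      by rewrite !inE => /orP[/set_mem/Qrot//|/eqP ->]; apply/E_rotationP.
    move=> /rotE [a _ ua] /rotE [b _ vb]; apply: E_inj.
    by rewrite !E_mul -ua -vb -!rotationD addrC.
  by apply/centsP => u uQ v vQ; apply: rot_commute.
have [u _ uf] := QG f Qf; rewrite -uf; apply/E_rotationP.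
have /centsP := ab; apply; rewrite !inE ?eqxx ?orbT //.
by apply/orP; left; apply/mem_set; rewrite uf.
Qed.

End ModQ.

(** * Discontinuities along an irrational orbit *)

Section Levels.
Variables (R : realType) (q : nat) (alpha : R).
Hypothesis q_gt0 : (0 < q)%N.
Hypothesis alpha_irr : irrational alpha.
Implicit Types (f h c t : iet R) (m n : int) (u : 'S_q).

Let q0 : 0 < q%:R :> R. Proof. by rewrite ltr0n. Qed.

(** The cosets m alpha + (1/q)Z, for m an integer, are the levels; an element
    with [lshifts f n] moves level m to level m + n, and [lregular f m] is
    continuity on level m. *)
Definition lshifts f n := shifts q f (n%:~R * alpha).
Definition lregular f m := regular q f (m%:~R * alpha).

(** Two equal levels would make an integer multiple of alpha rational. *)
Lemma lattice_inj n (k : int) : n%:~R * alpha = k%:~R / q%:R -> n = 0.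
Proof.
move=> e; apply: contrapT => /eqP n0; apply: alpha_irr.
have nR0 : n%:~R != 0 :> R by rewrite intr_eq0.
exists (k%:~R / (n%:~R * q%:R)) => //=.
rewrite fmorph_div rmorphM /= !ratr_int ratr_nat.
by rewrite invfM mulrA mulrAC -e mulrAC divff ?mul1r.
Qed.

Lemma lshifts_uniq f m n : lshifts f m -> lshifts f n -> m = n.
Proof.
move=> fm fn; have [k e] := shifts_uniq fm fn.
apply/eqP; rewrite -subr_eq0; apply/eqP; apply: (@lattice_inj _ k).
by rewrite rmorphB /=; lra.
Qed.

Lemma lshifts_mul f h m n : lshifts f m -> lshifts h n -> lshifts (f * h)%g (m + n).
Proof. by move=> fm hn; have := shifts_mul fm hn; rewrite -mulrDl -rmorphD. Qed.

Lemma lshifts_inv f n : lshifts f n -> lshifts f^-1%g (- n).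
Proof. by move=> /shifts_inv; rewrite /lshifts rmorphN mulNr. Qed.

Lemma lregular_mul f h n m m' : m' = m + n ->
  lshifts h n -> lregular h m -> lregular f m' -> lregular (f * h)%g m.
Proof.
move=> -> hn hm; rewrite /lregular rmorphD mulrDl; exact: regular_mul.
Qed.

Lemma lregular_inv f n m m' : m' = m + n ->
  lshifts f n -> lregular f m -> lregular f^-1%g m'.
Proof.
move=> -> fn fm; rewrite /lregular rmorphD mulrDl; exact: regular_inv.
Qed.

Lemma lshifts_conj c t n : lshifts c 0 -> lshifts t n -> lshifts (c ^ t)%g 0.
Proof.
move=> c0 tn; have := lshifts_mul (lshifts_inv tn) (lshifts_mul c0 tn).
by rewrite add0r addNr.
Qed.

Definition everywhere_regular f := forall m, lregular f m.

Lemma everywhere_regular_inv f n :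
  lshifts f n -> everywhere_regular f -> everywhere_regular f^-1%g.
Proof. by move=> fn fr m; apply: (lregular_inv _ fn (fr (m - n))); lia. Qed.

(** Conjugating by an everywhere continuous t raising levels by n translates the
    discontinuities of c by - n. *)
Lemma lregular_conj c t n m : lshifts t n -> everywhere_regular t -> lshifts c 0 ->
  lregular (c ^ t)%g m <-> lregular c (m + n).
Proof.
have half t' c' n' m' : lshifts t' n' -> everywhere_regular t' -> lshifts c' 0 ->
    lregular c' (m' + n') -> lregular (c' ^ t')%g m'.
  move=> tn tr c0 cr; apply: (@lregular_mul _ _ n' _ (m' + n')) => //.
  - by rewrite -[n']add0r; apply: lshifts_mul.
  - exact: (lregular_mul erefl tn (tr _) cr).
  - exact: everywhere_regular_inv tn tr _.
move=> tn tr c0; split=> [cr|]; last exact: half.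
rewrite -(conjgK t c); apply: (half _ _ (- n)).
- exact: lshifts_inv.
- exact: everywhere_regular_inv tn tr.
- exact: lshifts_conj c0 tn.
- by rewrite addrK.
Qed.

Notation T := (rotation alpha).

Lemma lshifts_rot (n : nat) : lshifts (T ^+ n)%g n.
Proof.
elim: n => [|n IH]; first by rewrite /lshifts mul0r; apply: shifts1.
rewrite expgS -[n.+1%:Z]/((1 + n)%N%:Z) PoszD; apply: lshifts_mul IH.
by rewrite /lshifts mul1r; apply: shifts_rotation.
Qed.

Lemma everywhere_regular_rot (n : nat) : everywhere_regular (T ^+ n)%g.
Proof.
elim: n => [|n IH] m.
  have -> : (T ^+ 0)%g = rotation 0 :> iet R.
    by apply: rotation_eq => p; rewrite addr0 circ_val.
  exact: regular_rotation.
rewrite expgS; apply: (lregular_mul erefl (lshifts_rot n)) => //.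
exact: regular_rotation.
Qed.

Section Generator.
Variable u : 'S_q.
Hypothesis uS : ~ commute u (sigma q).
Notation g := (E R u).

Lemma lshifts_E : lshifts g 0.
Proof. by rewrite /lshifts mul0r; apply: shifts_E. Qed.

(** The irrationality of alpha keeps every level but level 0 off (1/q)Z, and g,
    not being a rotation, is discontinuous somewhere on (1/q)Z. *)
Lemma lregular_E m : lregular g m <-> m <> 0.
Proof.
split=> [gm m0|m0].
  apply: uS; apply: (@regular_E_commute_sigma R _ q_gt0).
  by move: gm; rewrite /lregular m0 mul0r.
by apply: regular_E => // k; apply/eqP => /lattice_inj.
Qed.

Definition word (w : seq bool) : iet R := (\prod_(b <- w) (if b then T else T * g))%g.

Lemma word_cons b w : word (b :: w) = ((if b then T else T * g) * word w)%g.
Proof. exact: big_cons. Qed.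

Lemma lshifts_letter b : lshifts (if b then T else T * g)%g 1.
Proof.
have := lshifts_rot 1; case: b => // T1; rewrite -[1]addr0.
by apply: lshifts_mul lshifts_E.
Qed.

Lemma lshifts_word w : lshifts (word w) (size w).
Proof.
elim: w => [|b w IH]; first by rewrite /word big_nil; apply: (lshifts_rot 0).
rewrite word_cons -[Posz _]/((1 + size w)%N%:Z) PoszD.
exact: lshifts_mul (lshifts_letter b) IH.
Qed.

(** Starting from level m, the successive letters of w are applied on the levels
    m, ..., m + |w| - 1, which are all negative when m + |w| <= 0. *)
Lemma lregular_word w m : m + (size w)%:Z <= 0 -> lregular (word w) m.
Proof.
elim: w m => [|b w IH] m /= mw.
  by rewrite /word big_nil; apply: (everywhere_regular_rot 0).
rewrite word_cons; apply: (lregular_mul erefl (lshifts_word w)).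
  by apply: IH; lia.
have Tr := everywhere_regular_rot 1.
case: b => //; apply: (lregular_mul erefl lshifts_E) => //.
by apply/lregular_E; lia.
Qed.

(** Otherwise g = w w'^-1; from level 0, w'^-1 goes down to level - |w'| and w
    climbs back, and g and g^-1 are only applied on negative levels. *)
Lemma word_neq w w' : size w = size w' -> word w <> (g * word w')%g.
Proof.
move=> ww' e; have [] : ~ lregular g 0 by move/lregular_E.
have -> : g = (word w * (word w')^-1)%g by rewrite e mulgK.
have w'V : lshifts (word w')^-1%g (- (size w')%:Z).
  exact: lshifts_inv (lshifts_word w').
apply: (lregular_mul erefl w'V).
  apply: (lregular_inv (m := - (size w')%:Z) _ (lshifts_word w')); first lia.
  by apply: lregular_word; lia.
by apply: lregular_word; lia.
Qed.

(** T and T g generate a free semigroup, the empty word included. *)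
Lemma word_inj : injective word.
Proof.
move=> w w' e; have : size w = size w'.
  apply/eqP; rewrite -eqz_nat; apply/eqP; apply: (@lshifts_uniq (word w)).
    exact: lshifts_word.
  by rewrite e; apply: lshifts_word.
elim: w w' e => [|b w IH] [|b' w'] //; rewrite !word_cons => e [] ww'.
have [bb'|] := eqVneq b b'.
  by move: e; rewrite bb' => /mulgI /IH ->.
case: b b' e => -[] // /esym e _; exfalso; move: e.
  by rewrite -mulgA => /mulgI /esym; apply: word_neq.
by move=> /esym; rewrite -mulgA => /mulgI /esym; apply: word_neq.
Qed.

(** The lowest level of discontinuity of v is - j, that of g^(T^j), because
    g^(T^i) is only discontinuous on the higher level - i.  If - d is the lowest
    level of c, then - d - k is that of c^(T^k), hence also that of
    [~ c, T^k] = c^-1 c^(T^k) as c is continuous there. *)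
Lemma iter_commg_neq1 (i j k l : nat) : (i < j)%N -> (0 < k)%N ->
  iter_commg ((g ^ (T ^+ i))^-1 * g ^ (T ^+ j))%g (T ^+ k)%g l <> 1%g.
Proof.
move=> ij k0; set v := (_ * _)%g; set c := iter_commg v (T ^+ k)%g.
pose d (n : nat) : int := (j + k * n)%N%:Z.
have conj_reg (n : nat) m : lregular (g ^ (T ^+ n))%g m <-> m <> - n%:Z.
  rewrite (lregular_conj _ (lshifts_rot n) (everywhere_regular_rot n) lshifts_E).
  by rewrite lregular_E; split; lia.
have conj_shift (n : nat) : lshifts (g ^ (T ^+ n))%g 0.
  exact: lshifts_conj lshifts_E (lshifts_rot n).
have conj_shiftV (n : nat) : lshifts (g ^ (T ^+ n))^-1%g 0.
  by rewrite -oppr0; apply: lshifts_inv.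
have claim (n : nat) : [/\ lshifts (c n) 0, ~ lregular (c n) (- d n) &
    forall m, m < - d n -> lregular (c n) m].
  elim: n => [|n [cs cd cm]].
    split.
    - by rewrite -[0]addr0; apply: lshifts_mul.
    - move=> vd; have [] : ~ lregular (g ^ (T ^+ j))%g (- d 0%N).
        by rewrite conj_reg /d muln0 addn0; apply.
      have -> : (g ^ (T ^+ j) = g ^ (T ^+ i) * v)%g by rewrite mulVKg.
      apply: (lregular_mul erefl (lshifts_mul (conj_shiftV i) (conj_shift j))) => //.
      by rewrite conj_reg /d; lia.
    - move=> m; rewrite /d => md; apply: (lregular_mul erefl (conj_shift j)).
        by rewrite conj_reg; lia.
      apply: (lregular_inv (m := m) _ (conj_shift i)); first by rewrite addr0.
      by rewrite conj_reg; lia.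
  have cS : c n.+1 = ((c n)^-1 * c n ^ (T ^+ k))%g by [].
  have cJs : lshifts (c n ^ (T ^+ k))%g 0 by exact: lshifts_conj cs (lshifts_rot k).
  have cJr m := lregular_conj m (lshifts_rot k) (everywhere_regular_rot k) cs.
  have cVs : lshifts (c n)^-1%g 0 by rewrite -oppr0; apply: lshifts_inv.
  have dS : d n.+1 = d n + k%:Z by rewrite /d; lia.
  have cSs : lshifts (c n.+1) 0 by rewrite cS -[0]addr0; apply: lshifts_mul.
  split=> //.
  - move=> cr; apply: cd; have -> : - d n = - d n.+1 + k%:Z by rewrite dS; lia.
    apply/cJr; have -> : (c n ^ (T ^+ k) = c n * c n.+1)%g by rewrite cS mulVKg.
    by apply: (lregular_mul erefl cSs cr); apply: cm; lia.
  - move=> m md; rewrite cS; apply: (lregular_mul erefl cJs).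
      by apply/cJr; apply: cm; lia.
    apply: (lregular_inv _ cs (cm m _)); lia.
move=> c1; have [_ + _] := claim l; rewrite [c l]c1; apply.
exact: (everywhere_regular_rot 0).
Qed.

End Generator.
End Levels.

(** * Local finiteness of the kernel *)

Section Amenable.
Variables (R : realType) (q : nat).
Hypothesis q_gt0 : (0 < q)%N.
Implicit Types (f h : iet R) (p y : I01 R) (a : R).

Let q0 : 0 < q%:R :> R. Proof. by rewrite ltr0n. Qed.

Lemma shiftable_subgroup : is_subgroup [set f | exists a, shifts q f a].
Proof.
split; first by exists 0; apply: shifts1.
move=> f h [a fa] [b hb]; exists (a - b).
by apply: shifts_mul fa _; apply: shifts_inv.
Qed.

(** The action of f on R / (1/q)Z, rescaled by q to a rotation of R / Z.
    Reading it off at the single point 0 avoids choosing the angle a. *)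
Definition rotation_part f : iet R := rotation (q%:R * val (f (circ 0))).

Lemma rotation_partE f a : shifts q f a -> rotation_part f = rotation (q%:R * a).
Proof.
move=> fa; have [k e] := shifts_circ q_gt0 0 fa.
apply: rotation_eq => p; rewrite /rotation_part -circ_valD e.
by apply: (@circ_int _ _ _ k); rewrite add0r mulrDr [_ * (_ / _)]mulrC mulfVK ?gt_eqF // addrA.
Qed.

Lemma rotation_part_eq1 f a : shifts q f a -> rotation_part f = 1%g -> shifts q f 0.
Proof.
move=> fa; rewrite (rotation_partE fa) => /(congr1 (fun h : iet R => h (circ 0))).
rewrite rotation_circ => /circ_eq_int [k]; rewrite !add0r => e p.
have [j ->] := fa p; exists (j + k); rewrite rmorphD /= mulrDl -e.
by rewrite [q%:R * a]mulrC mulfK ?gt_eqF //; lra.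
Qed.

(** The points above y for the map x |-> q x of the circle. *)
Definition fiber_point y (i : 'I_q) : I01 R := circ ((i%:R + val y) / q%:R).

Lemma I01_bounds y : 0 <= val y < 1.
Proof. exact: (valP y). Qed.

Lemma fiber_pointE y i :
  val (fiber_point y i) = i%:R / q%:R + val y / q%:R /\
  cell q (fiber_point y i) = Some i.
Proof.
have /andP[y0 y1] := I01_bounds y.
have h : i%:R / q%:R <= i%:R / q%:R + val y / q%:R < i%:R / q%:R + q%:R^-1.
  rewrite lerDl ltrD2l divr_ge0 ?ler0n //=.
  by rewrite ltr_pdivrMr // mulVf ?gt_eqF.
have e : val (fiber_point y i) = i%:R / q%:R + val y / q%:R.
  by rewrite /fiber_point mulrDl circ_id //; apply: cell01 h.
by split=> //; apply/cell_bounds => //; rewrite e.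
Qed.

Lemma fiber_point_inj y : injective (fiber_point y).
Proof.
by move=> i j e; have := (fiber_pointE y i).2; rewrite e (fiber_pointE y j).2 => -[].
Qed.

Lemma fiber_pointP p : exists y i, p = fiber_point y i.
Proof.
have [i ip] := cell_some p q_gt0; have /cell_bounds/andP[h1 h2] := ip.
have y01 : 0 <= q%:R * val p - i%:R < 1.
  rewrite subr_ge0 ltrBlDl [q%:R * _]mulrC -ler_pdivrMr // h1 /=.
  by rewrite -ltr_pdivlMr // mulrDl mul1r.
exists (circ (q%:R * val p - i%:R)), i; apply: val_inj.
by rewrite (fiber_pointE _ i).1 circ_id // mulrBl [q%:R * _]mulrC mulfK ?gt_eqF //; lra.
Qed.

Lemma shifts0_fiber f y : shifts q f 0 ->
  exists s : 'S_q, forall i, f (fiber_point y i) = fiber_point y (s i).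
Proof.
move=> f0.
have ex i : exists j, f (fiber_point y i) = fiber_point y j.
  have [j cj] := cell_some (f (fiber_point y i)) q_gt0; exists j.
  have [k e] := f0 (fiber_point y i); move: e.
  have [-> _] := fiber_pointE y i => e.
  have /andP[y0 y1] := I01_bounds y.
  have /cell_bounds/andP := cj; rewrite e => -[h1 h2].
  have jk : (j%:R : R) = i%:R + k%:~R.
    suff /(congr1 (fun z : int => z%:~R : R)) : (j : int) = (i : int) + k.
      by rewrite rmorphD.
    apply/eqP; rewrite eq_le -!ltzD1 -!(ltr_int R) !rmorphD /=.
    rewrite -!pmulrn; apply/andP; split.
      have : j%:R / q%:R * q%:R <= (i%:R / q%:R + val y / q%:R + 0 + k%:~R / q%:R) * q%:R.
        by rewrite ler_pM2r.
      by rewrite addr0 !mulrDl !mulfVK ?gt_eqF //; lra.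
    have : (i%:R / q%:R + val y / q%:R + 0 + k%:~R / q%:R) * q%:R <
        (j%:R / q%:R + q%:R^-1) * q%:R by rewrite ltr_pM2r.
    by rewrite addr0 !mulrDl !mulfVK ?gt_eqF // mulVf ?gt_eqF //; lra.
  by apply: val_inj; rewrite e (fiber_pointE y j).1 jk mulrDl; lra.
pose s i := sval (cid (ex i)).
have sP i : f (fiber_point y i) = fiber_point y (s i) by exact: svalP (cid (ex i)).
have s_inj : injective s.
  move=> i j /(congr1 (fiber_point y)); rewrite -!sP.
  by move=> /(bij_inj (iet_bij f)) /fiber_point_inj.
by exists (perm s_inj) => i; rewrite permE.
Qed.

(** The kernel of [rotation_part] acts on each fibre through S_q, and faithfully
    on the union of the fibres. *)
Lemma shiftable_elementary_amenable (H : subgroup (iet R)) :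
  (forall f, sg_carrier H f -> exists a, shifts q f a) ->
  elementary_amenable H /\ chou_EG 2 H.
Proof.
move=> Hsh.
pose rp (f : H) := rotation_part (val f).
have rpM : {morph rp : x y / (x * y)%g}.
  move=> f h; have [a fa] := Hsh _ (subgroup_val f).
  have [b hb] := Hsh _ (subgroup_val h).
  rewrite /rp (rotation_partE fa) (rotation_partE hb) -rotationD -mulrDr.
  by apply: rotation_partE; apply: shifts_mul.
have ker0 (x : hom_kernel rpM) : shifts q (val (val x)) 0.
  have [a xa] := Hsh _ (subgroup_val (val x)).
  exact: rotation_part_eq1 xa (subgroup_val x).
pose s x y := sval (cid (shifts0_fiber y (ker0 x))).
have sP (x : hom_kernel rpM) y i : val (val x) (fiber_point y i) = fiber_point y (s x y i).
  exact: (svalP (cid (shifts0_fiber y (ker0 x)))).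
apply: (@locally_finite_by_abelian _ _ rp rpM _ _ _ (fun x y => (s x y)^-1%g)).
(* The inverse turns the left-to-right product of S_q into that of iets. *)
- by move=> f h; rewrite /commute /rp /rotation_part -!rotationD addrC.
- move=> x z y; rewrite -invMg; congr (_^-1)%g; apply/permP => i.
  by apply: (@fiber_point_inj y); rewrite permM -!sP.
- move=> x z e; apply: val_inj; apply: val_inj; apply: iet_ext => p.
  have [y [i ->]] := fiber_pointP p.
  by rewrite !sP; have /invg_inj -> := e y.
Qed.

End Amenable.

(** * The dichotomy *)

Lemma rotations_subgroup (R : realType) : is_subgroup (@rotations R).
Proof.
have r0 : rotation 0 = 1%g :> iet R.
  by apply: esym; apply: rotation_eq => p; rewrite addr0 circ_val.
split; first by exists 0.
move=> _ _ [a _ <-] [b _ <-]; exists (a - b) => //.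
by apply: (mulIg (rotation b)); rewrite -rotationD subrK mulgVK.
Qed.

Theorem theorem1 (R : realType) (s m q : nat)
    (s_gt0 : (0 < s)%N) (m_gt0 : (0 < m)%N) (q_gt0 : (0 < q)%N)
    (alpha : 'I_s -> R)
    (alpha_irr : forall i, irrational (alpha i))
    (alpha_indep : Q_independent alpha)
    (g : 'I_m -> iet R)
    (gG : forall j, G_1q q (g j)) :
  let Q : subgroup (iet R) := subgroup_gen (range g) in
  let H : subgroup (iet R) :=
    subgroup_gen (range (fun i => rotation (alpha i)) `|` range g) in
  [/\ Q `<=` @rotations R <-> abelian_group H,
      Q `<=` @rotations R <->
        abelian <<frakS q Q :|: [set sigma q]%SET>>%g
    & Q `<=` @rotations R \/
      (exists2 f : iet R, sg_carrier Q f & ~ rotations f) /\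
      [/\ elementary_amenable H /\ chou_EG 2 H,
          ~ virtually_nilpotent H,
          contains_free_semigroup2 H
        & exponential_growth H]].
Proof.
move=> Q H.
have QG : Q `<=` @G_1q R q.
  by apply: subgroup_gen_sub; [exact: G_1q_subgroup|move=> _ [j _ <-]].
have QH : Q `<=` H.
  apply: subgroup_gen_sub; first exact: sg_is_subgroup.
  by move=> f gf; apply: sub_subgroup_gen; right.
pose a := alpha (Ordinal s_gt0); have a_irr : irrational a by exact: alpha_irr.
have HT : sg_carrier H (rotation a).
  by apply: sub_subgroup_gen; left; exists (Ordinal s_gt0).
pose T : H := in_subgroup HT.
have Hshift : H `<=` [set f | exists b, shifts q f b].
  apply: subgroup_gen_sub; first exact: shiftable_subgroup.
  move=> _ [[i _ <-]|[j _ <-]]; first by exists (alpha i); apply: shifts_rotation.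
  by have [u _ <-] := gG j; exists 0; apply: shifts_E.
split.
- split=> [Qrot|Hab f Qf].
    have Hrot : H `<=` @rotations R.
      apply: subgroup_gen_sub; first exact: rotations_subgroup.
      move=> f [[i _ <-]|gf]; first by exists (alpha i).
      by apply: Qrot; apply: sub_subgroup_gen.
    move=> x y; apply: val_inj; rewrite !valM.
    have [b _ <-] := Hrot _ (subgroup_val x).
    have [c _ <-] := Hrot _ (subgroup_val y).
    by rewrite -!rotationD addrC.
  have [u _ uf] := QG f Qf; rewrite -uf; apply/(E_rotationP _ q_gt0).
  apply: contrapT => uS.
  (* f = f^T is discontinuous on level 0 by assumption, on level - 1 only by
     conjugation. *)
  have fT : (f ^ (rotation a ^+ 1))%g = f.
    have /(congr1 val) := Hab (in_subgroup (QH _ Qf)) T; rewrite !valM /= => fT.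
    by rewrite expg1 conjgE fT mulKg.
  have : ~ lregular q a f 0 by rewrite -uf (lregular_E q_gt0 a_irr uS).
  apply; rewrite -fT (lregular_conj q_gt0 _ (lshifts_rot a q_gt0 1)).
  + by rewrite -uf (lregular_E q_gt0 a_irr uS).
  + exact: everywhere_regular_rot.
  + by rewrite -uf; apply: lshifts_E.
- exact: rotations_abelian_sigma.
have [|nQ] := pselect (Q `<=` @rotations R); [by left|right].
have [f Qf frot] : exists2 f, sg_carrier Q f & ~ rotations f.
  by apply: contrapT => h; apply: nQ => f Qf; apply: contrapT => frot; apply: h; exists f.
have [u _ uf] := QG f Qf.
have uS : ~ commute u (sigma q) by move/(E_rotationP R q_gt0); rewrite uf.
have HE : sg_carrier H (E R u) by rewrite uf; apply: QH.
pose g0 : H := in_subgroup HE.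
have free : contains_free_semigroup2 H.
  exists T, (T * g0)%g => w w' _ _ /(congr1 val) e.
  apply: (word_inj q_gt0 a_irr uS); rewrite /word.
  suff valw v : val (\prod_(t <- v) (if t then T else T * g0))%g = word a u v.
    by move: e; rewrite !valw.
  rewrite /word gmulf_prod; apply: eq_bigr => t _.
  by case: t => /=; rewrite ?valM.
split; first by exists f.
split=> //.
- exact: (shiftable_elementary_amenable q_gt0).
- move=> /(virtually_nilpotent_iter_commg (fun n => g0 ^ (T ^+ n))%g T).
  move=> [i [j [k [l [ij k0 e]]]]].
  apply: (@iter_commg_neq1 R q a q_gt0 a_irr u uS i j k l ij k0).
  have := iter_commg_morph (val : subgroup_type H -> iet R)
    ((g0 ^ (T ^+ i))^-1 * g0 ^ (T ^+ j))%g (T ^+ k)%g l.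
  by rewrite e gmulf1 !gmulfM !gmulfV !gmulfJ !gmulfXn => <-.
- apply: free_semigroup_exponential_growth => //; apply: finite_set_generates.
  by rewrite finite_setU; split; apply: finite_image; apply: finite_finset.
Qed.
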